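(* Let $p\in\mathbb{N}$, $0\le\gamma_1<\dots<\gamma_p\le1$, $\boldsymbol\alpha=(\alpha_1,\dots,\alpha_p)\in(0,1)^p$ with $\sum_i\alpha_i=1$, and for each $i$ let $(\gamma_{i,n})_n$ be $[0,1]$-valued with $|\gamma_{i,n}-\gamma_i|=O(1/n)$. Define $\phi_{n,\boldsymbol\alpha,\boldsymbol\gamma_n}(u)=\sum_{i=1}^p\alpha_i\phi_{n,\gamma_{i,n}}(u)$, $u\in[0,1]$. Let $F_X,F_Y$ be continuous, strictly increasing cdfs with finite second moments, and let $X_{n,\boldsymbol\alpha,\boldsymbol\gamma_n}$, $Y_{n,\boldsymbol\alpha,\boldsymbol\gamma_n}$ have cdfs $\phi_{n,\boldsymbol\alpha,\boldsymbol\gamma_n}\circ F_X=\sum_i\alpha_iF_{X_{1+[(n-1)\gamma_{i,n}]:n}}$ and $\phi_{n,\boldsymbol\alpha,\boldsymbol\gamma_n}\circ F_Y$ respectively (mixtures of order statistics of samples of size $n$ from $F_X$, resp. $F_Y$). Suppose there are $\delta_1,\dots,\delta_p>0$, with the sets $(\gamma_i-\delta_i,\gamma_i+\delta_i)\cap[0,1]$ pairwise disjoint, such that: for each $i$, if $\gamma_i-\delta_i\le a<b<\gamma_i$ or $\gamma_i<b<a\le\gamma_i+\delta_i$ then $\phi_{n,\boldsymbol\alpha,\boldsymbol\gamma_n}'(a)/\phi_{n,\boldsymbol\alpha,\boldsymbol\gamma_n}'(b)\to0$ as $n\to\infty$; and for every $i$, (A1) $\max\{F_X(c_{\gamma_i}),\gamma_i-\delta_i\}<F_X(a_{\gamma_i})$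 whenever $A_2\cap(0,\gamma_i)\neq\emptyset$; (A2) $F_X(b_{\gamma_i})<\min\{F_X(d_{\gamma_i}),\gamma_i+\delta_i\}$ whenever $A_2\cap(\gamma_i,1)\neq\emptyset$. Then $X_{n,\boldsymbol\alpha,\boldsymbol\gamma_n}\le_{\textnormal{d-ast}}Y_{n,\boldsymbol\alpha,\boldsymbol\gamma_n}$ as $n\to\infty$.
   Context: $[x]$ denotes the integer part. For $n\ge2$, $\alpha\in[0,1]$, $t\in[0,1]$: $\phi_{n,\alpha}(t)=\sum_{j=1+[(n-1)\alpha]}^n\binom{n}{j}t^j(1-t)^{n-j}$; the cdf of the $(1+[(n-1)\alpha])$-th smallest order statistic $X_{1+[(n-1)\alpha]:n}$ of an i.i.d. sample of size $n$ from $F_X$ is $\phi_{n,\alpha}\circ F_X$. For a cdf $F$, $F^{-1}(u)=\inf\{x:F(x)\ge u\}$. $\mathcal{W}_2(F,G)=(\int_0^1(F^{-1}-G^{-1})^2du)^{1/2}$; $\varepsilon_{\mathcal{W}_2}(F,G)=\mathcal{W}_2^{-2}(F,G)\int_{\{u:F^{-1}(u)>G^{-1}(u)\}}(F^{-1}-G^{-1})^2du$ (set to $0$ if $\mathcal{W}_2(F,G)=0$). $X_n\le_{\textnormal{d-ast}}Y_n$ means $\varepsilon_{\mathcal{W}_2}(F_{X_n},F_{Y_n})\to0$. $A_2=\{u\in(0,1):F_X^{-1}(u)\ne F_Y^{-1}(u)\}$, $B_0=\{x:F_X(x)<F_Y(x)\}$, $B_2=\{x:F_X(x)\neq F_Y(x)\}$;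 $c_\gamma=\sup(B_0\cap(-\infty,F_X^{-1}(\gamma)))$, $d_\gamma=\inf(B_0\cap(F_X^{-1}(\gamma),\infty))$, $a_\gamma=\sup(B_2\cap(-\infty,F_X^{-1}(\gamma)))$, $b_\gamma=\inf(B_2\cap(F_X^{-1}(\gamma),\infty))$, with $\sup\emptyset=-\infty$, $\inf\emptyset=+\infty$, $F_X(\mp\infty)=0,1$. *)

(* Defs.v *)
From HB Require Import structures.
From mathcomp Require Import all_boot all_order all_algebra.
From mathcomp Require Import all_classical all_reals all_analysis.
Set Implicit Arguments. Unset Strict Implicit. Unset Printing Implicit Defensive.
Import Order.TTheory GRing.Theory Num.Theory.
Import numFieldNormedType.Exports.
Local Open Scope classical_set_scope.
Local Open Scope ring_scope.

Definition phi {R : realType} (n : nat) (a : R) (t : R) : R :=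
  \sum_((Num.truncn ((n.-1)%:R * a)).+1 <= j < n.+1)
     ('C(n, j))%:R * t ^+ j * (1 - t) ^+ (n - j).

Definition phi_mix {R : realType} (p n : nat) (alpha gam : 'I_p -> R) (u : R) : R :=
  \sum_(i < p) alpha i * phi n (gam i) u.

(* generalized inverse F^{-1}(u) = inf {x : F x >= u}, in the extended reals
   (inf of the empty set is +oo, of an unbounded-below set -oo) *)
Definition Finv {R : realType} (F : R -> R) (u : R) : \bar R :=
  ereal_inf (EFin @` [set x : R | u <= F x]).

Definition Fext {R : realType} (F : R -> R) (x : \bar R) : R :=
  match x with
  | EFin r => F r
  | +oo%E => 1
  | -oo%E => 0
  end.

Definition W2sq {R : realType} (F G : R -> R) : \bar R :=
  (\int[lebesgue_measure]_(u in `]0%R, 1%R[%classic)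
      ((fine (Finv F u) - fine (Finv G u)) ^+ 2)%R%:E)%E.

Definition W2sq_pos {R : realType} (F G : R -> R) : \bar R :=
  (\int[lebesgue_measure]_(u in [set u : R | (0 < u < 1)%R /\ (Finv G u < Finv F u)%E])
      ((fine (Finv F u) - fine (Finv G u)) ^+ 2)%R%:E)%E.

(* epsilon_{W2}(F,G); equals 0 when W2(F,G) = 0 (since x / 0 = 0) *)
Definition epsW2 {R : realType} (F G : R -> R) : R :=
  fine (W2sq_pos F G) / fine (W2sq F G).

Definition A2 {R : realType} (FX FY : R -> R) : set R :=
  [set u | 0 < u < 1 /\ Finv FX u <> Finv FY u].

Definition B0 {R : realType} (FX FY : R -> R) : set R := [set x | FX x < FY x].
Definition B2 {R : realType} (FX FY : R -> R) : set R := [set x | FX x != FY x].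

Definition c_ {R : realType} (FX FY : R -> R) (g : R) : \bar R :=
  ereal_sup (EFin @` (B0 FX FY `&` [set x | (x%:E < Finv FX g)%E])).
Definition d_ {R : realType} (FX FY : R -> R) (g : R) : \bar R :=
  ereal_inf (EFin @` (B0 FX FY `&` [set x | (Finv FX g < x%:E)%E])).
Definition a_ {R : realType} (FX FY : R -> R) (g : R) : \bar R :=
  ereal_sup (EFin @` (B2 FX FY `&` [set x | (x%:E < Finv FX g)%E])).
Definition b_ {R : realType} (FX FY : R -> R) (g : R) : \bar R :=
  ereal_inf (EFin @` (B2 FX FY `&` [set x | (Finv FX g < x%:E)%E])).

Definition cdfR {d} {T : measurableType d} {R : realType} (P : probability T R)
  (X : {RV P >-> R}) (x : R) : R := fine (cdf X x).

(* Main.v *)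
Require Import Defs.
From HB Require Import structures.
From mathcomp Require Import all_boot all_order all_algebra.
From mathcomp Require Import all_classical all_reals all_analysis.
From mathcomp Require Import measurable_realfun ring lra.
Import Order.TTheory GRing.Theory Num.Theory.
Import numFieldNormedType.Exports.
Local Open Scope classical_set_scope.
Local Open Scope ring_scope.
Set Implicit Arguments. Unset Strict Implicit. Unset Printing Implicit Defensive.

(* Write q for quantile functions. Substituting u = phi_n(t), the numerator and the
   denominator of epsilon are the integrals over ]0, 1[ of max(q_X - q_Y, 0)^2 phi_n' and
   h phi_n', where h := (q_X - q_Y)^2 is integrable by the second moment hypothesis.
   The density phi_n' is the sum of the alpha_i f_i with f_i a unimodal beta density
   whose mode tends to gamma_i. By (A1) and (A2), for every i the points t < gamma_i
   with q_X(t) > q_Y(t) lie below some a < gamma_i, and h > 0 somewhere in ]a, gamma_i[;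
   similarly on the right of gamma_i. Unimodality gives
   alpha_i f_i(t) <= alpha_i f_i(a) <= phi_n'(a) at such t for large n, so the numerator
   is at most the integral of h times a sum of finitely many values phi_n'(a). By the
   ratio condition, phi_n' / phi_n'(a) tends to +oo pointwise on ]a, gamma_i[, and Fatou's
   lemma makes each phi_n'(a) negligible with respect to the denominator. *)

(** * Two facts on limits of sequences *)

Section limits.
Context {R : realType}.

(** Each term is at least the infimum of its tail, so tail infima tending to +oo drag the sequence
    along. It turns the lower limit that Fatou's lemma controls into a limit. *)
Lemma limn_einf_pinfty (u : (\bar R)^nat) : limn_einf u = +oo%E -> u @ \oo --> +oo%E.
Proof.
rewrite limn_einf_lim => lu.
have : einfs u @ \oo --> +oo%E by rewrite -lu; exact: is_cvg_einfs.
move=> /cvgeyPge eu; apply/cvgeyPge => A; have := eu A; apply: filterS => n An.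
by apply: (le_trans An); apply: ereal_inf_lbound; exists n => //=.
Qed.

Lemma cvg_sum0 (I : Type) (r : seq I) (u : I -> nat -> R) :
  (forall i, u i n @[n --> \oo] --> (0 : R)) ->
  \sum_(i <- r) u i n @[n --> \oo] --> (0 : R).
Proof.
move=> u0; elim: r => [|i r IH].
  by under eq_fun do rewrite big_nil; exact: cvg_cst.
under eq_fun do rewrite big_cons.
by have := cvgD (u0 i) IH; rewrite addr0; apply.
Qed.

End limits.

(** * Quantile functions of continuous, strictly increasing cdfs *)

Section quantile.
Context {R : realType}.
Implicit Types (F G : R -> R) (x y u t : R).

(** An increasing bijection from the line onto ]0, 1[. This form is shared by the two cdfs and by
    their compositions with phi_n, so one theory of quantiles serves both. *)
Definition incr_onto01 F :=
  [/\ {homo F : x y / x < y}, forall x, 0 < F x < 1 &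
      forall u, 0 < u < 1 -> exists x, F x = u].

Lemma incr_onto01_le F : incr_onto01 F -> {mono F : x y / x <= y}.
Proof. by case=> /le_mono. Qed.

Lemma incr_onto01_lt F : incr_onto01 F -> {mono F : x y / x < y}.
Proof. by move=> /incr_onto01_le/leW_mono. Qed.

Definition quantile F u := fine (Finv F u).

Lemma Finv_cdf F x : incr_onto01 F -> Finv F (F x) = x%:E.
Proof.
move=> hF; rewrite /Finv; apply/eqP; rewrite eq_le; apply/andP; split.
  by apply: ereal_inf_lbound; exists x => /=.
apply: le_ereal_inf_tmp => _ [y /= + <-].
by rewrite (incr_onto01_le hF) lee_fin.
Qed.

Lemma quantile_cdf F x : incr_onto01 F -> quantile F (F x) = x.
Proof. by move=> hF; rewrite /quantile Finv_cdf. Qed.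

Lemma cdf_quantile F u : incr_onto01 F -> 0 < u < 1 -> F (quantile F u) = u.
Proof. by move=> hF u01; have [_ _ /(_ _ u01)[x <-]] := hF; rewrite quantile_cdf. Qed.

Lemma FinvE F u : incr_onto01 F -> 0 < u < 1 -> Finv F u = (quantile F u)%:E.
Proof. by move=> hF u01; have [_ _ /(_ _ u01)[x <-]] := hF; rewrite quantile_cdf// Finv_cdf. Qed.

Lemma quantile_lt F u x : incr_onto01 F -> 0 < u < 1 -> (quantile F u < x) = (u < F x).
Proof. by move=> hF u01; rewrite -(incr_onto01_lt hF) cdf_quantile. Qed.

Lemma quantile_gt F u x : incr_onto01 F -> 0 < u < 1 -> (x < quantile F u) = (F x < u).
Proof. by move=> hF u01; rewrite -(incr_onto01_lt hF) cdf_quantile. Qed.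

(** With x the quantile of u, the quantile of v is within e of x exactly when F (x - e) < v < F (x +
    e), an open condition on v that u satisfies. *)
Lemma quantile_continuous F u : incr_onto01 F -> 0 < u < 1 ->
  {for u, continuous (quantile F)}.
Proof.
move=> hF u01; apply/cvgrPdist_lt => e e0.
set x := quantile F u.
have l1 : F (x - e) < u by rewrite -quantile_gt// ltrBlDr ltrDl.
have l2 : u < F (x + e) by rewrite -quantile_lt// ltrDl.
have [u0 u1] := andP u01.
near=> v.
have v01 : 0 < v < 1.
  apply/andP; split; near: v; [exact: lt_nbhsr|exact: lt_nbhsl].
rewrite ltr_distlC quantile_gt// quantile_lt//; apply/andP; split; near: v; [exact: lt_nbhsr|exact: lt_nbhsl].
Unshelve. all: by end_near. Qed.

(** Strict monotonicity keeps the values off 0 and 1, by comparison with x - 1 and x + 1. The limits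
    at infinity and the intermediate value theorem give surjectivity. *)
Lemma cdfR_onto01 d (T : measurableType d) (P : probability T R) (X : {RV P >-> R}) :
  continuous (cdfR X) -> {homo cdfR X : x y / x < y} -> incr_onto01 (cdfR X).
Proof.
move=> cF sF.
have fin r : cdf X r \is a fin_num by rewrite fin_num_measure.
have F0 x : 0 <= cdfR X x by rewrite fine_ge0// cdf_ge0.
have F1 x : cdfR X x <= 1.
  by rewrite -lee_fin /cdfR fineK// cdf_le1.
have cy : cdfR X @ +oo --> (1 : R) by exact/fine_cvg/cvg_cdfy1.
have cNy : cdfR X @ -oo --> (0 : R) by exact/fine_cvg/cvg_cdfNy0.
split=> //.
- move=> x; apply/andP; split.
    by rewrite (le_lt_trans (F0 (x - 1)))// sF// ltrBlDr ltrDl.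
  by rewrite (lt_le_trans _ (F1 (x + 1)))// sF// ltrDl.
- move=> u /andP[u0 u1].
  have [a aP] : exists a, cdfR X a < u.
    have : \forall x \near -oo, cdfR X x < u.
      exact: (cvgr_lt 0 cNy).
    by move=> /(@filter_ex _ _ (@proper_ninfty_nbhs R)).
  have [b bP] : exists b, u < cdfR X b.
    have : \forall x \near +oo, u < cdfR X x.
      exact: (cvgr_gt 1 cy).
    by move=> /(@filter_ex _ _ (@proper_pinfty_nbhs R)).
  have ab : a <= b.
    rewrite leNgt; apply/negP => /sF; move: aP bP; lra.
  have mM : Num.min (cdfR X a) (cdfR X b) <= u <= Num.max (cdfR X a) (cdfR X b).
    by rewrite ge_min le_max (ltW aP) (ltW bP) orbT.
  have [c _ cu] := IVT ab (continuous_subspaceT cF) mM.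
  by exists c.
Qed.

End quantile.

(** * Beta densities as derivatives of the phi_n *)

Section beta_density.
Context {R : realType}.
Implicit Types (t s : R) (n k : nat).

(* density of the (k+1)-th smallest of n independent uniform variables *)
Definition beta_density n k t : R :=
  (n * 'C(n.-1, k))%:R * t ^+ k * (1 - t) ^+ (n.-1 - k).

Lemma beta_density_ge0 n k t : 0 <= t <= 1 -> 0 <= beta_density n k t.
Proof. by move=> /andP[t0 t1]; rewrite !mulr_ge0 ?exprn_ge0 ?subr_ge0. Qed.

Lemma beta_density_gt0 n k t : (k < n)%N -> 0 < t < 1 -> 0 < beta_density n k t.
Proof.
move=> kn /andP[t0 t1]; rewrite !mulr_gt0 ?exprn_gt0 ?subr_gt0// ltr0n muln_gt0.
by rewrite (leq_ltn_trans _ kn)// bin_gt0 -ltnS prednK// (leq_ltn_trans _ kn).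
Qed.

(* x <= exp (x - 1) reduces unimodality to a linear inequality between exponents *)
Lemma beta_density_unimodal n k t s : (k < n)%N -> 0 < t < 1 -> 0 < s < 1 ->
  (t - s) * (k%:R - n.-1%:R * s) <= 0 -> beta_density n k t <= beta_density n k s.
Proof.
move=> kn /andP[t0 t1] /andP[s0 s1] ts.
rewrite /beta_density -!mulrA ler_wpM2l//.
have kn1 : (k <= n.-1)%N by rewrite -ltnS prednK// (leq_ltn_trans _ kn).
have [m nE] : exists m, n.-1 = (k + m)%N by exists (n.-1 - k)%N; rewrite subnKC.
rewrite nE addKn; rewrite nE natrD in ts.
have s10 : 0 < 1 - s by rewrite subr_gt0.
have t10 : 0 < 1 - t by rewrite subr_gt0.
have h (x : R) j : 0 < x -> x ^+ j <= expR (j%:R * (x - 1)).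
  move=> x0; rewrite mulrC expRM_natr; apply: lerXn2r; rewrite ?nnegrE ?expR_ge0 ?(ltW x0)//.
  by have := expR_ge1Dx (x - 1); rewrite addrCA subrr addr0.
have -> : t ^+ k * (1 - t) ^+ m =
    ((t / s) ^+ k * ((1 - t) / (1 - s)) ^+ m) * (s ^+ k * (1 - s) ^+ m).
  by rewrite !expr_div_n mulrACA !divfK// expf_neq0// gt_eqF.
apply: ler_piMl; first by rewrite mulr_ge0 ?exprn_ge0 ?ltW.
apply: (@le_trans _ _ (expR (k%:R * (t / s - 1)) * expR (m%:R * ((1 - t) / (1 - s) - 1)))).
  by rewrite ler_pM ?h ?exprn_ge0 ?divr_gt0 ?divr_ge0// ltW.
rewrite -expRD -[leRHS]expR0 ler_expR.
have -> : k%:R * (t / s - 1) + m%:R * ((1 - t) / (1 - s) - 1) =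
   ((t - s) * (k%:R - (k%:R + m%:R) * s)) / (s * (1 - s)).
  by field; rewrite gt_eqF//= gt_eqF.
by rewrite mulr_le0_ge0// invr_ge0 ltW// mulr_gt0.
Qed.

(** Formal polynomials make the derivative an algebraic computation, and its continuity on the whole
    line comes for free. *)
Definition bernstein_poly n j : {poly R} := 'C(n, j)%:R *: ('X^j * (1 - 'X) ^+ (n - j)).

(** With N = n + 1, the identities N C(N-1, j) = (j+1) C(N, j+1) and N C(N-1, j+1) = (N-j-1) C(N,
    j+1) turn the two terms of the product rule into beta densities. *)
Lemma deriv_bernstein_poly n j t :
  (bernstein_poly n.+1 j.+1)^`().[t] = beta_density n.+1 j t - beta_density n.+1 j.+1 t.
Proof.
rewrite /bernstein_poly derivZ derivM derivXn deriv_exp derivB derivX derivC !hornerE /=.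
rewrite /beta_density /= subSS mul_bin_diag (mul_bin_down n.+1) subSS !natrM subnS.
rewrite !hornerMn !hornerE -(mulr_natr (t ^+ j)) -(mulr_natr (-1 * _)); ring.
Qed.

Definition phi_poly n (a : R) : {poly R} :=
  \sum_((Num.truncn (n.-1%:R * a)).+1 <= j < n.+1) bernstein_poly n j.

Lemma horner_phi_poly n a t : (phi_poly n a).[t] = phi n a t.
Proof.
rewrite /phi_poly /phi horner_sum; apply: eq_bigr => j _.
by rewrite !hornerE ?mulrA.
Qed.

Lemma truncn_rank_lt n (a : R) : (0 < n)%N -> a <= 1 ->
  (Num.truncn (n.-1%:R * a) < n)%N.
Proof.
move=> n0 a1; rewrite -[X in (_ < X)%N](prednK n0) ltnS.
have /le_truncn : n.-1%:R * a <= n.-1%:R by rewrite ler_piMr.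
by rewrite natrK.
Qed.

(** The derivatives of the Bernstein terms are consecutive differences, so the sum telescopes to its
    first term. The far end carries the factor C(n-1, n) = 0. *)
Lemma deriv_phi_poly n a t : (0 < n)%N -> a <= 1 ->
  (phi_poly n a)^`().[t] = beta_density n (Num.truncn (n.-1%:R * a)) t.
Proof.
move=> n0 a1; rewrite /phi_poly; have := truncn_rank_lt n0 a1.
set k := Num.truncn _; case: n n0 @k => // n _ k kn.
rewrite (raddf_sum (@deriv R)) horner_sum big_add1 /=.
rewrite (@telescope_sumr_eq _ _ _ (fun j => - beta_density n.+1 j t)) ?(ltnW kn)//.
  by rewrite opprK /beta_density /= bin_small// muln0 !mul0r oppr0 add0r.
by move=> j _; rewrite deriv_bernstein_poly opprK addrC.
Qed.

Lemma phi0 n (a : R) : phi n a 0 = 0.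
Proof.
rewrite /phi big_nat_cond big1// => j /andP[/andP[j0 _] _].
by rewrite expr0n gtn_eqF ?mulr0 ?mul0r// (leq_ltn_trans _ j0).
Qed.

Lemma phi1 n (a : R) : (0 < n)%N -> a <= 1 -> phi n a 1 = 1.
Proof.
move=> n0 a1; rewrite /phi big_nat_recr/=; last exact: truncn_rank_lt.
rewrite big_nat_cond big1 ?add0r => [|j /andP[/andP[_ jn] _]].
  by rewrite binn subnn expr1n expr0 !mulr1.
by rewrite subrr expr0n subn_eq0 leqNgt jn mulr0.
Qed.

End beta_density.

(** * Polynomial cdfs on [0, 1] and the substitution u = P(t) *)

Section cdf_poly.
Context {R : realType}.
Implicit Types (P : {poly R}) (F G : R -> R) (t u : R).

(** Positivity is asked only in the open interval, since beta densities may vanish at 0 and 1. *)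
Definition cdf_poly01 P :=
  [/\ P.[0] = 0, P.[1] = 1 & forall t, 0 < t < 1 -> 0 < P^`().[t]].

Lemma cdf_poly01_lt P : cdf_poly01 P -> {in `[0, 1] &, {homo horner P : t u / t < u}}.
Proof.
case=> _ _ dP; apply: gtr0_derive1_lt_cc => [t _|t|].
- exact: derivable_horner.
- by rewrite in_itv/= -derivE; exact: dP.
- exact/continuous_subspaceT/continuous_horner.
Qed.

Lemma cdf_poly01_le P : cdf_poly01 P -> {in `[0, 1] &, {mono horner P : t u / t <= u}}.
Proof. by move=> /cdf_poly01_lt/le_mono_in. Qed.

Lemma cdf_poly01_bound P t : cdf_poly01 P -> 0 < t < 1 -> 0 < P.[t] < 1.
Proof.
move=> hP /andP[t0 t1]; have [P0 P1 _] := hP.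
apply/andP; split; [rewrite -P0|rewrite -[ltRHS]P1];
  by apply: cdf_poly01_lt => //; rewrite in_itv/= ?lexx ?ler01 ?(ltW t0) ?(ltW t1).
Qed.

Lemma cdf_poly01_onto P u : cdf_poly01 P -> 0 < u < 1 ->
  exists2 t, 0 < t < 1 & P.[t] = u.
Proof.
move=> [P0 P1 _] /andP[u0 u1].
have mM : Num.min P.[0] P.[1] <= u <= Num.max P.[0] P.[1].
  by rewrite P0 P1 ge_min le_max (ltW u0) (ltW u1) orbT.
have [t] := IVT ler01 (continuous_subspaceT (@continuous_horner _ P)) mM.
rewrite in_itv/= => /andP[t0 t1] Ptu; exists t => //.
rewrite !lt_neqAle t0 t1 !andbT; apply/andP; split; apply/eqP => tE.
  by move: u0; rewrite -Ptu -tE P0 ltxx.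
by move: u1; rewrite -Ptu tE P1 ltxx.
Qed.

Lemma incr_onto01_poly P F : cdf_poly01 P -> incr_onto01 F -> incr_onto01 (horner P \o F).
Proof.
move=> hP [F1 F2 F3]; have F4 x : F x \in `[0, 1].
  by rewrite in_itv/=; have /andP[/ltW-> /ltW->] := F2 x.
split=> [x y xy /=|x|u u01].
- by apply: cdf_poly01_lt => //; exact: F1.
- exact: cdf_poly01_bound.
- have [t t01 <-] := cdf_poly01_onto hP u01.
  by have [x <-] := F3 _ t01; exists x.
Qed.

(** P is strictly increasing on [0, 1], so P(t) <= P(F x) and t <= F x define the same set of x, and
    the infima agree. *)
Lemma Finv_poly P F t : cdf_poly01 P -> incr_onto01 F -> 0 < t < 1 ->
  Finv (horner P \o F) P.[t] = Finv F t.
Proof.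
move=> hP [_ F2 _] /andP[t0 t1]; rewrite /Finv; congr (ereal_inf (_ @` _)).
apply/seteqP; split=> x /=; rewrite cdf_poly01_le// in_itv/= ?(ltW t0) ?(ltW t1)//;
  by have /andP[/ltW-> /ltW->] := F2 x.
Qed.

Local Notation mu := (@lebesgue_measure R).

Let natSinv_lt k : (k.+3%:R^-1 : R) < 1 - k.+3%:R^-1.
Proof.
rewrite ltrBrDr (@le_lt_trans _ _ (3^-1 + 3^-1))//; last by lra.
by rewrite lerD// lef_pV2 ?posrE// ler_nat.
Qed.

Lemma measurable_fun_itv01 (g : R -> R) :
  (forall u, 0 < u < 1 -> {for u, continuous g}) ->
  measurable_fun (`]0, 1[%classic : set R) g.
Proof.
move=> cg; apply: open_continuous_measurable_fun.
  exact: interval_open.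
move=> u; rewrite inE/= in_itv/=; exact: cg.
Qed.

(** The function g may be unbounded near 0 and 1. The change of variables is therefore made on
    compact intervals inside ]0, 1[, and both sides pass to the limit by monotone convergence. *)
Lemma integral_poly_substitution P (g : R -> R) : cdf_poly01 P ->
  (forall u, 0 < u < 1 -> {for u, continuous g}) ->
  (forall u, 0 <= g u) ->
  (\int[mu]_(u in `]0%R, 1%R[) (g u)%:E =
   \int[mu]_(t in `]0%R, 1%R[) (g P.[t] * P^`().[t])%:E)%E.
Proof.
move=> hP cg g0; have [P0 P1 dP] := hP.
(* The offset 3 makes e k at most 1/3, so that e k < 1 - e k already for k = 0. *)
pose e k : R := k.+3%:R^-1.
have e0 k : 0 < e k by rewrite invr_gt0.
have e1 k : 1 - e k < 1 by rewrite ltrBlDr ltrDl.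
have e01 k : 0 < e k < 1 by rewrite e0/= (lt_trans (natSinv_lt k)).
have e01' k : 0 < 1 - e k < 1 by rewrite e1 andbT (lt_trans (e0 k) (natSinv_lt k)).
have ein k : e k \in `[0, 1] by rewrite in_itv/=; have /andP[/ltW-> /ltW->] := e01 k.
have ein' k : 1 - e k \in `[0, 1] by rewrite in_itv/=; have /andP[/ltW-> /ltW->] := e01' k.
have elt k : e k < 1 - e k by exact: natSinv_lt.
have ele m n : (m <= n)%N -> e n <= e m.
  by move=> mn; rewrite lef_pV2 ?posrE// ler_nat.
have subI k : `[e k, 1 - e k]%classic `<=` `]0, 1[%classic.
  by move=> x /=; rewrite !in_itv/= => /andP[x0 x1]; rewrite (lt_le_trans (e0 k))//= (le_lt_trans x1).
have subJ k : `[P.[e k], P.[1 - e k]]%classic `<=` `]0, 1[%classic.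
  move=> x /=; rewrite !in_itv/= => /andP[x0 x1].
  have /andP[l1 _] := cdf_poly01_bound hP (e01 k).
  have /andP[_ l2] := cdf_poly01_bound hP (e01' k).
  by rewrite (lt_le_trans l1)//= (le_lt_trans x1).
have exe t : 0 < t < 1 -> exists k, e k <= t <= 1 - e k.
  move=> /andP[t0 t1]; pose d := Num.min t (1 - t).
  have d0 : 0 < d by rewrite lt_min t0 subr_gt0.
  have [k kd] : exists k : nat, e k < d.
    have := near_infty_natSinv_lt (PosNum d0) => -[k _ /(_ k (leqnn _))/= kd].
    by exists k; rewrite (le_lt_trans _ kd)// lef_pV2 ?posrE// ler_nat leqW.
  exists k; move: kd; rewrite lt_min => /andP[/ltW-> /ltW].
  by rewrite lerBrDr addrC -lerBrDr.
have bI : \bigcup_k `[e k, 1 - e k]%classic = `]0, 1[%classic.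
  apply/seteqP; split=> [x [k _ /subI//]|x /=].
  by rewrite in_itv/= => /exe[k xk]; exists k => //=; rewrite in_itv.
have bJ : \bigcup_k `[P.[e k], P.[1 - e k]]%classic = `]0, 1[%classic.
  apply/seteqP; split=> [x [k _ /subJ//]|x /=].
  rewrite in_itv/= => /(cdf_poly01_onto hP)[t t01 <-].
  have tin : t \in `[0, 1] by rewrite in_itv/=; have /andP[/ltW-> /ltW->] := t01.
  have [k tk] := exe _ t01; exists k => //=; rewrite in_itv/=.
  by rewrite (cdf_poly01_le hP (ein k) tin) (cdf_poly01_le hP tin (ein' k)).
have cgP t : 0 < t < 1 -> {for t, continuous (fun t => g P.[t] * P^`().[t])}.
  move=> t01; apply: continuousM; last exact: continuous_horner.
  apply: continuous_comp; first exact: continuous_horner.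
  exact/cg/cdf_poly01_bound.
have mg : measurable_fun (`]0, 1[%classic : set R) (EFin \o g).
  by apply/measurable_EFinP; apply: measurable_fun_itv01.
have mgP : measurable_fun (`]0, 1[%classic : set R) (EFin \o (fun t => g P.[t] * P^`().[t])).
  by apply/measurable_EFinP; apply: measurable_fun_itv01.
have c1 := @ge0_nondecreasing_set_cvg_integral _ (measurableTypeR R) R
  (fun k => `[P.[e k], P.[1 - e k]]%classic) (fun u => (g u)%:E) mu.
have c2 := @ge0_nondecreasing_set_cvg_integral _ (measurableTypeR R) R
  (fun k => `[e k, 1 - e k]%classic) (fun t => (g P.[t] * P^`().[t])%:E) mu.
rewrite bJ in c1; rewrite bI in c2.
(* The two sequences of truncated integrals coincide term by term, so their limits do. *)
apply: (cvg_unique _ (c1 _ _ _ _)) => //.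
- move=> m n mn; apply/subsetPset/subset_itv; rewrite bnd_simp cdf_poly01_le//.
    exact: ele.
  by rewrite lerB// ele.
- by move=> k; apply: measurable_funS mg.
- by move=> k x _; rewrite lee_fin.
apply: cvg_trans (c2 _ _ _ _) => //; last first.
- move=> k x /subI /=; rewrite in_itv/= => x01.
  by rewrite lee_fin mulr_ge0// ltW// dP.
- by move=> k; apply: measurable_funS mgP.
- move=> m n mn; apply/subsetPset/subset_itv; rewrite bnd_simp ?ele//.
  by rewrite lerB// ele.
apply: near_eq_cvg; apply: nearW => k.
rewrite (@integration_by_substitution_increasing R (horner P) g)//.
- by apply: eq_integral => t _ /=; rewrite -derivE.
- exact: ltW.
- by move=> x y /subI/subset_itv_oo_cc xI /subI/subset_itv_oo_cc yI; exact: cdf_poly01_lt.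
- by move=> x _; rewrite -derivE; exact: continuous_horner.
- rewrite -derivE; apply/cvg_ex; exists P^`().[e k]; apply: cvg_at_right_filter; exact: continuous_horner.
- rewrite -derivE; apply/cvg_ex; exists P^`().[1 - e k]; apply: cvg_at_left_filter; exact: continuous_horner.
- split; first by move=> x _; exact: derivable_horner.
    apply: cvg_at_right_filter; exact: continuous_horner.
  apply: cvg_at_left_filter; exact: continuous_horner.
- apply: continuous_in_subspaceT => u; rewrite inE => /subJ/=; rewrite in_itv/=; exact: cg.
Qed.

End cdf_poly.

(** * The Wasserstein integrals in the variable t *)

Section wasserstein.
Context {R : realType}.
Implicit Types (P : {poly R}) (F G : R -> R) (t u : R).
Local Notation mu := (@lebesgue_measure R).

Definition qdist F G t : R := (quantile F t - quantile G t) ^+ 2.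
(** Taking the positive part before squaring replaces the restriction to the set where F has the
    larger quantile by an integrand continuous on all of ]0, 1[, as the substitution requires. *)
Definition qdist_pos F G t : R := Num.max (quantile F t - quantile G t) 0 ^+ 2.

Lemma qdist_ge0 F G t : 0 <= qdist F G t. Proof. exact: sqr_ge0. Qed.

Lemma qdist_pos_ge0 F G t : 0 <= qdist_pos F G t. Proof. exact: sqr_ge0. Qed.

Lemma qdist_pos_le F G t : qdist_pos F G t <= qdist F G t.
Proof.
rewrite /qdist_pos /qdist maxEle; case: ifP => // _.
by rewrite expr0n sqr_ge0.
Qed.

Lemma quantileB_continuous F G t : incr_onto01 F -> incr_onto01 G -> 0 < t < 1 ->
  {for t, continuous (fun t => quantile F t - quantile G t)}.
Proof. by move=> hF hG t01; apply: continuousB; exact: quantile_continuous. Qed.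

Lemma qdist_continuous F G t : incr_onto01 F -> incr_onto01 G -> 0 < t < 1 ->
  {for t, continuous (qdist F G)}.
Proof.
move=> hF hG t01.
apply: (@continuous_comp _ _ _ (fun t => quantile F t - quantile G t) (fun x => x ^+ 2)).
  exact: quantileB_continuous.
exact: exprn_continuous.
Qed.

Lemma qdist_pos_continuous F G t : incr_onto01 F -> incr_onto01 G -> 0 < t < 1 ->
  {for t, continuous (qdist_pos F G)}.
Proof.
move=> hF hG t01.
apply: (@continuous_comp _ _ _ (fun t => Num.max (quantile F t - quantile G t) 0) (fun x => x ^+ 2)).
  apply: (@continuous_max _ _ (fun t => quantile F t - quantile G t) (cst 0)).
    exact: quantileB_continuous.
  exact: cst_continuous.
exact: exprn_continuous.
Qed.

Lemma W2sq_poly P F G : cdf_poly01 P -> incr_onto01 F -> incr_onto01 G ->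
  W2sq (horner P \o F) (horner P \o G) =
  (\int[mu]_(t in `]0%R, 1%R[) (qdist F G t * P^`().[t])%:E)%E.
Proof.
move=> hP hF hG; have hPF := incr_onto01_poly hP hF; have hPG := incr_onto01_poly hP hG.
rewrite /W2sq (integral_poly_substitution (g := qdist (horner P \o F) (horner P \o G)) hP).
- apply: eq_integral => t; rewrite inE/= in_itv/= => t01.
  by rewrite /qdist /quantile !Finv_poly.
- by move=> u u01; exact: qdist_continuous.
- by move=> u; exact: qdist_ge0.
Qed.

Lemma W2sq_pos_poly P F G : cdf_poly01 P -> incr_onto01 F -> incr_onto01 G ->
  W2sq_pos (horner P \o F) (horner P \o G) =
  (\int[mu]_(t in `]0%R, 1%R[) (qdist_pos F G t * P^`().[t])%:E)%E.
Proof.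
move=> hP hF hG; have hPF := incr_onto01_poly hP hF; have hPG := incr_onto01_poly hP hG.
(* First enlarge the domain to ]0, 1[: the new integrand is 0 on the added part. *)
transitivity (\int[mu]_(u in `]0%R, 1%R[) (qdist_pos (horner P \o F) (horner P \o G) u)%:E)%E.
  rewrite /W2sq_pos integral_mkcond [RHS]integral_mkcond.
  apply: eq_integral => u _; rewrite !patchE.
  have [u01|u01] := boolP (u \in `]0, 1[%classic); last first.
    rewrite memNset// => -[u01' _]; move: u01; rewrite notin_setE/= in_itv/=.
    by rewrite u01'.
  move: u01; rewrite inE/= in_itv/= => u01.
  have E : (Finv (horner P \o G) u < Finv (horner P \o F) u)%E =
           (quantile (horner P \o G) u < quantile (horner P \o F) u).
    by rewrite !FinvE.
  rewrite /qdist_pos; case: ifPn.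
    rewrite inE/= E => -[_ /ltW lt]; rewrite max_l ?subr_ge0//.
  rewrite notin_setE/= E => /not_andP[//|/negP]; rewrite -leNgt => le.
  by rewrite max_r ?subr_le0// expr0n.
rewrite (integral_poly_substitution (g := qdist_pos (horner P \o F) (horner P \o G)) hP).
- apply: eq_integral => t; rewrite inE/= in_itv/= => t01.
  by rewrite /qdist_pos /quantile !Finv_poly.
- by move=> u u01; exact: qdist_pos_continuous.
- by move=> u; exact: qdist_pos_ge0.
Qed.

End wasserstein.

(** * The second moment as an integral of the squared quantile function *)

Section second_moment.
Context {R : realType} d (T : measurableType d) (P : probability T R) (X : {RV P >-> R}).
Local Notation mu := (@lebesgue_measure R).
Hypotheses (cF : continuous (cdfR X)) (sF : {homo cdfR X : x y / x < y}).

Let F := cdfR X.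
Let hF : incr_onto01 F := cdfR_onto01 cF sF.

Let FX : T -> measurableTypeR R := F \o X.

Let mFX : measurable_fun setT FX.
Proof. by apply: measurableT_comp => //; exact: continuous_measurable_fun. Qed.

Let U_mixin := isMeasurableFun.Build _ _ _ _ FX mFX.
Let U : {RV P >-> measurableTypeR R} := HB.pack FX U_mixin.

Let cdf_fin r : cdf X r \is a fin_num.
Proof. by rewrite fin_num_measure. Qed.

(** Probability integral transform: F(X) is uniform on ]0, 1[. The half-lines ]x, +oo[ are stable
    under intersection and generate the Borel sets, so it suffices to compare the two measures
    there, in the cases x <= 0, x >= 1 and 0 < x < 1. *)
Let cdfR_uniform (A : set (measurableTypeR R)) : measurable A ->
  distribution P U A = mrestr mu (measurable_itv `]0%R, 1%R[) A.
Proof.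
have [_ F01 _] := hF.
apply: (@measure_unique _ R (measurableTypeR R) (@RGenOInfty.G R) (fun k => `]- k%:R, +oo[%classic) _ _ _ _ (distribution P U) (mrestr mu (measurable_itv `]0%R, 1%R[))).
- exact: RGenOInfty.measurableE.
- move=> _ _ [x ->] [y ->]; exists (Num.max x y); apply/seteqP; split=> z /=; rewrite !in_itv/= !andbT gt_max.
    by move=> [-> ->].
  by move=> /andP[].
- by move=> k; exists (- k%:R).
- apply/seteqP; split=> // x _; exists (Num.truncn (- x)).+1 => //=.
  by rewrite in_itv/= andbT ltrNl Num.Theory.truncnS_gt.
- move=> _ [x ->]; change (P (FX @^-1` `]x, +oo[%classic) = mu (`]x, +oo[%classic `&` `]0%R, 1%R[%classic)).
  have [x0|x0] := leP x 0.
    rewrite [X in P X](_ : _ = setT); last first.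
      apply/seteqP; split=> // t _ /=; rewrite in_itv/= andbT (le_lt_trans x0)//.
      by have /andP[] := F01 (X t).
    rewrite [X in mu X](_ : _ = `]0, 1[%classic); last first.
      apply/seteqP; split=> [t []//|t /= t01]; split=> //; move: t01.
      by rewrite !in_itv/= andbT => /andP[t0 _]; rewrite (le_lt_trans x0).
    by rewrite probability_setT lebesgue_measure_itv/= lte_fin ltr01 oppr0 adde0.
  have [x1|x1] := leP 1 x.
    rewrite [X in P X](_ : _ = set0); last first.
      apply/seteqP; split=> // t /=; rewrite in_itv/= andbT => xt.
      by have /andP[_] := F01 (X t); rewrite ltNge (le_trans x1 (ltW xt)).
    rewrite [X in mu X](_ : _ = set0) ?measure0//.
    apply/seteqP; split=> // t [] /=; rewrite !in_itv/= andbT => xt /andP[_].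
    by rewrite ltNge (le_trans x1 (ltW xt)).
  have x01 : 0 < x < 1 by rewrite x0.
  (* F(X) > x means that X exceeds the quantile of x, an event of probability 1 - x. *)
  rewrite [X in P X](_ : _ = ~` (X @^-1` `]-oo, quantile F x])); last first.
    apply/seteqP; split=> t /=; rewrite !in_itv/= andbT.
      by rewrite -quantile_lt// => /lt_geF->.
    by move/negP; rewrite -ltNge quantile_lt.
  rewrite probability_setC//; last exact: measurable_funPTI.
  rewrite (_ : P _ = x%:E); last first.
    by rewrite -[X in _ = X%:E](cdf_quantile hF x01) /F /cdfR fineK.
  rewrite [X in mu X](_ : _ = `]x, 1[%classic); last first.
    apply/seteqP; split=> t /=; rewrite !in_itv/= ?andbT.
      by move=> [-> /andP[]].
    by move=> /andP[xt ->]; rewrite xt (lt_trans x0).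
  by rewrite lebesgue_measure_itv/= lte_fin x1.
- move=> k; rewrite (le_lt_trans (probability_le1 _ _)) ?ltry//.
Qed.

(** Lebesgue measure on ]0, 1[ is the law of F(X), and the quantile function sends F(X) back to X;
    so the integral is one over the probability space. *)
Lemma integral_quantile_sqr :
  (\int[mu]_(u in `]0%R, 1%R[) (quantile F u ^+ 2)%:E =
   'E_P[fun t => (X t ^+ 2)%R])%E.
Proof.
have [_ F01 _] := hF.
rewrite (@eq_measure_integral _ _ _ _ (distribution P U)); last first.
  move=> A mA A01; rewrite [RHS]cdfR_uniform// /mrestr.
  by rewrite setIidl.
rewrite ge0_integral_pushforward//.
- rewrite (_ : _ @^-1` _ = setT); last first.
    by apply/seteqP; split=> // t _ /=; rewrite in_itv/= F01.
  rewrite expectation.unlock; apply: eq_integral => t _ /=.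
  by rewrite /FX /= quantile_cdf.
- apply/measurable_EFinP; apply: (@measurable_fun_itv01 R (fun u => quantile F u ^+ 2)) => u u01.
  apply: (@continuous_comp _ _ _ (quantile F) (fun x => x ^+ 2)).
    exact: quantile_continuous.
  exact: exprn_continuous.
- by move=> u _; rewrite lee_fin sqr_ge0.
Qed.

End second_moment.

(** * The gaps beside gamma that (A1) and (A2) provide *)

Section crossing.
Context {R : realType}.
Variables (F G : R -> R).
Hypotheses (hF : incr_onto01 F) (hG : incr_onto01 G).
Implicit Types (t u a g : R).

(** The set that carries the numerator of epsilon. *)
Definition A0 t := 0 < t < 1 /\ quantile G t < quantile F t.

Lemma Fext_le : {homo Fext F : x y / (x <= y)%E >-> x <= y}.
Proof.
have [_ F01 _] := hF.
case=> [x| |] [y| |]//=; rewrite ?lee_fin ?(incr_onto01_le hF)//.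
- by have /andP[_ /ltW] := F01 x.
- by have /andP[/ltW] := F01 y.
Qed.

Lemma A2_cdf x : F x != G x -> A2 F G (F x).
Proof.
move=> FGx; have [_ F01 _] := hF; split; first exact: F01.
rewrite !FinvE// quantile_cdf// => -[/(congr1 G)]; rewrite cdf_quantile// => GF.
by move: FGx; rewrite GF eqxx.
Qed.

Lemma A0_A2 t : A0 t -> A2 F G t.
Proof.
move=> [t01 lt]; split=> //; rewrite !FinvE// => -[e].
by move: lt; rewrite e ltxx.
Qed.

Lemma A2_quantile t : A2 F G t -> quantile F t <> quantile G t.
Proof. by move=> [t01]; rewrite !FinvE// => + e; rewrite e. Qed.

(** For x the F-quantile of t one has F x = t, and a smaller G-quantile means t < G x. So points of
    [A0] show up in the sets that define [c_] and [d_]. *)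
Lemma A0_B0 t : A0 t -> B0 F G (quantile F t).
Proof. by move=> [t01]; rewrite quantile_lt// /B0 /= cdf_quantile. Qed.

Lemma A0_near t : A0 t -> \forall t' \near t, A0 t'.
Proof.
move=> [t01 lt]; have [t0 t1] := andP t01.
near=> t'; split.
  by apply/andP; split; near: t'; [exact: lt_nbhsr|exact: lt_nbhsl].
rewrite -subr_gt0; near: t'.
apply: (cvgr_gt (quantile F t - quantile G t)); last by rewrite subr_gt0.
exact: quantileB_continuous.
Unshelve. all: by end_near. Qed.

Lemma A0_left t a : A0 t -> a < t -> exists2 t', A0 t' & a < t' < t.
Proof.
move=> A0t at_.
have : \forall t' \near t^'-, A0 t' /\ a < t' < t.
  near=> t'; split; [|apply/andP; split]; near: t'.
  - exact/cvg_within/A0_near.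
  - exact: nbhs_left_gt.
  - exact: nbhs_left_lt.
by move=> /(@filter_ex _ _ (at_left_proper_filter t))[t' [? ?]]; exists t'.
Unshelve. all: by end_near. Qed.

Lemma A0_right t a : A0 t -> t < a -> exists2 t', A0 t' & t < t' < a.
Proof.
move=> A0t at_.
have : \forall t' \near t^'+, A0 t' /\ t < t' < a.
  near=> t'; split; [|apply/andP; split]; near: t'.
  - exact/cvg_within/A0_near.
  - exact: nbhs_right_gt.
  - exact: nbhs_right_lt.
by move=> /(@filter_ex _ _ (at_right_proper_filter t))[t' [? ?]]; exists t'.
Unshelve. all: by end_near. Qed.

Lemma lt_Finv t g : 0 < t < 1 -> t < g -> g <= 1 ->
  ((quantile F t)%:E < Finv F g)%E.
Proof.
move=> /andP[t0 t1] tg g1.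
(* The midpoint has a finite quantile even for g = 1, where [Finv F g] is +oo. *)
have m01 : 0 < (t + g) / 2 < 1 by lra.
apply: (@lt_le_trans _ _ (quantile F ((t + g) / 2))%:E).
  by rewrite lte_fin quantile_lt ?t0// cdf_quantile//; lra.
apply: le_ereal_inf_tmp => _ [y /= gy <-].
rewrite lee_fin leNgt quantile_gt// -leNgt; lra.
Qed.

Lemma Finv_lt t g : 0 < t < 1 -> g < t -> 0 <= g ->
  (Finv F g < (quantile F t)%:E)%E.
Proof.
move=> /andP[t0 t1] tg g1.
have m01 : 0 < (t + g) / 2 < 1 by lra.
apply: (@le_lt_trans _ _ (quantile F ((t + g) / 2))%:E); last first.
  by rewrite lte_fin quantile_lt ?t0// cdf_quantile ?t0//; lra.
apply: ereal_inf_lbound; exists (quantile F ((t + g) / 2)) => //=.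
rewrite cdf_quantile//; lra.
Qed.

Lemma cdf_lt_Finv x g : (x%:E < Finv F g)%E -> F x < g.
Proof.
by move=> xg; rewrite ltNge; apply/negP => gx; move: xg; rewrite ltNge => /negP; apply;
  apply: ereal_inf_lbound; exists x.
Qed.

Lemma Finv_lt_cdf x g : (Finv F g < x%:E)%E -> g < F x.
Proof.
move=> /ereal_inf_lt[_ [y /= gy <-]]; rewrite lte_fin => yx.
by rewrite (le_lt_trans gy)// (incr_onto01_lt hF).
Qed.

(** Take for a the larger of F(c) and g - dl. Points of [A0] below g have their quantiles below c,
    hence lie below a. As a < F(a_), some x in [B2] has a < F x < g, and s := F x is a point where
    the quantiles differ. *)
Lemma left_gap g dl t0 : g <= 1 -> A0 t0 -> t0 <= g ->
  ((exists u, A2 F G u /\ 0 < u < g) ->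
    Fext F (c_ F G g) < Fext F (a_ F G g) /\ g - dl < Fext F (a_ F G g)) ->
  exists a s, [/\ 0 < a < 1, g - dl <= a, a < s < g,
    quantile F s <> quantile G s & forall t, A0 t -> t <= g -> t <= a].
Proof.
move=> g1 At0 t0g A1.
(* (A1) asks for a point strictly below g, while t0 may equal g; [A0] is open, so one can move
   left. *)
have [t1 At1 /andP[t10 t1t0]] : exists2 t1, A0 t1 & 0 < t1 < t0.
  by apply: A0_left => //; case: At0 => /andP[].
have t1g : t1 < g by exact: lt_le_trans t0g.
have [cA gA] : Fext F (c_ F G g) < Fext F (a_ F G g) /\ g - dl < Fext F (a_ F G g).
  by apply: A1; exists t1; split; [exact: A0_A2|rewrite t10].
pose a := Num.max (Fext F (c_ F G g)) (g - dl).
have tc t : A0 t -> t < g -> t <= Fext F (c_ F G g).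
  move=> At tg; have [t01 _] := At.
  rewrite -[leLHS](cdf_quantile hF t01).
  apply: (@Fext_le (quantile F t)%:E); apply: ereal_sup_ubound.
  by exists (quantile F t) => //; split; [exact: A0_B0|exact: lt_Finv].
have a0 : 0 < a by rewrite lt_max (lt_le_trans t10)// tc.
have aA : a < Fext F (a_ F G g) by rewrite gt_max cA.
have a1 : a < 1.
  rewrite (lt_le_trans aA)// (le_trans (Fext_le (leey _)))//.
have a01 : 0 < a < 1 by rewrite a0.
have [x [FGx xg] ax] : exists2 x, (B2 F G `&` [set x | (x%:E < Finv F g)%E]) x & a < F x.
  (* Otherwise the quantile of a bounds the set with supremum [a_], which forces F(a_) <= a. *)
  apply: contrapT => nex; move: aA; rewrite ltNge => /negP; apply.
  rewrite -[leRHS](cdf_quantile hF a01).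
  apply: (@Fext_le _ (quantile F a)%:E); apply: ge_ereal_sup => _ [x Bx <-].
  rewrite lee_fin leNgt quantile_lt//; apply/negP => ax.
  by apply: nex; exists x.
have Fxg := cdf_lt_Finv xg.
exists a, (F x); split=> //.
- by rewrite le_max lexx orbT.
- by rewrite ax.
- exact/A2_quantile/A2_cdf.
(* If g itself were in the open set [A0], so would be some t' with a < t' < g, which has just been
   excluded. *)
- move=> t At; rewrite le_eqVlt => /predU1P[tg|tg]; last first.
    by rewrite le_max tc.
  rewrite leNgt; apply/negP => at_.
  have [t' At' /andP[at' t't]] := A0_left At at_.
  by move: at'; rewrite ltNge le_max tc// -tg.
Qed.

(** Mirror image of the left side, with the infima [d_] and [b_] and a minimum for a. *)
Lemma right_gap g dl t0 : 0 <= g -> A0 t0 -> g <= t0 ->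
  ((exists u, A2 F G u /\ g < u < 1) ->
    Fext F (b_ F G g) < Fext F (d_ F G g) /\ Fext F (b_ F G g) < g + dl) ->
  exists a s, [/\ 0 < a < 1, a <= g + dl, g < s < a,
    quantile F s <> quantile G s & forall t, A0 t -> g <= t -> a <= t].
Proof.
move=> g1 At0 t0g A1.
have [t1 At1 /andP[t1t0 t11]] : exists2 t1, A0 t1 & t0 < t1 < 1.
  by apply: A0_right => //; case: At0 => /andP[].
have t1g : g < t1 by exact: le_lt_trans t1t0.
have [cA gA] : Fext F (b_ F G g) < Fext F (d_ F G g) /\ Fext F (b_ F G g) < g + dl.
  by apply: A1; exists t1; split; [exact: A0_A2|rewrite t11 andbT].
pose a := Num.min (Fext F (d_ F G g)) (g + dl).
have tc t : A0 t -> g < t -> Fext F (d_ F G g) <= t.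
  move=> At tg; have [t01 _] := At.
  rewrite -[leRHS](cdf_quantile hF t01).
  apply: (@Fext_le _ (quantile F t)%:E); apply: ereal_inf_lbound.
  by exists (quantile F t) => //; split; [exact: A0_B0|exact: Finv_lt].
have a1 : a < 1 by rewrite gt_min (le_lt_trans _ t11)// tc.
have aA : Fext F (b_ F G g) < a by rewrite lt_min cA.
have a0 : 0 < a.
  rewrite (le_lt_trans _ aA)// (le_trans _ (Fext_le (leNye _)))//.
have a01 : 0 < a < 1 by rewrite a0.
have [x [FGx xg] ax] : exists2 x, (B2 F G `&` [set x | (Finv F g < x%:E)%E]) x & F x < a.
  apply: contrapT => nex; move: aA; rewrite ltNge => /negP; apply.
  rewrite -[leLHS](cdf_quantile hF a01).
  apply: (@Fext_le (quantile F a)%:E); apply: le_ereal_inf_tmp => _ [x Bx <-].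
  rewrite lee_fin leNgt quantile_gt//; apply/negP => ax.
  by apply: nex; exists x.
have Fxg := Finv_lt_cdf xg.
exists a, (F x); split=> //.
- by rewrite ge_min lexx orbT.
- by rewrite ax andbT.
- exact/A2_quantile/A2_cdf.
- move=> t At; rewrite le_eqVlt => /predU1P[tg|tg]; last first.
    by rewrite ge_min tc.
  rewrite leNgt; apply/negP => at_.
  have [t' At' /andP[at' t't]] := A0_right At at_.
  by move: t't; rewrite ltNge ge_min tc// tg.
Qed.

End crossing.

(** * Estimates of numerator and denominator *)

Section asymptotics.
Context {R : realType}.
Variables (F G : R -> R).
Hypotheses (hF : incr_onto01 F) (hG : incr_onto01 G).
Local Notation mu := (@lebesgue_measure R).
Implicit Types (P : {poly R}) (t a : R).

Definition W2den P : \bar R :=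
  (\int[mu]_(t in `]0%R, 1%R[) (qdist F G t * P^`().[t])%:E)%E.

Definition W2num P : \bar R :=
  (\int[mu]_(t in `]0%R, 1%R[) (qdist_pos F G t * P^`().[t])%:E)%E.

Lemma measurable_qdistM P :
  measurable_fun (`]0, 1[%classic : set R) (EFin \o (fun t => qdist F G t * P^`().[t])).
Proof.
apply/measurable_EFinP; apply: measurable_fun_itv01 => u u01.
by apply: continuousM; [exact: qdist_continuous|exact: continuous_horner].
Qed.

Lemma measurable_qdist_posM P :
  measurable_fun (`]0, 1[%classic : set R) (EFin \o (fun t => qdist_pos F G t * P^`().[t])).
Proof.
apply/measurable_EFinP; apply: measurable_fun_itv01 => u u01.
by apply: continuousM; [exact: qdist_pos_continuous|exact: continuous_horner].
Qed.

Lemma measurable_qdist :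
  measurable_fun (`]0, 1[%classic : set R) (EFin \o qdist F G).
Proof.
by apply/measurable_EFinP; apply: measurable_fun_itv01 => u u01; exact: qdist_continuous.
Qed.

(** The squared distance between F and G themselves, free of n. *)
Definition qdist_int : \bar R := (\int[mu]_(t in `]0%R, 1%R[) (qdist F G t)%:E)%E.

Lemma integral_qdistZ (c : R) : 0 <= c ->
  (\int[mu]_(t in `]0%R, 1%R[) (c%:E * (qdist F G t)%:E) = c%:E * qdist_int)%E.
Proof.
move=> c0; apply: ge0_integralZl => //; first exact: measurable_qdist.
by move=> t _; rewrite lee_fin qdist_ge0.
Qed.

(** Off [A0] the integrand is 0, so a bound on the density is wanted only there. *)
Lemma le_W2num P (B : R) : cdf_poly01 P -> 0 <= B ->
  (forall t, A0 F G t -> P^`().[t] <= B) -> (W2num P <= B%:E * qdist_int)%E.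
Proof.
move=> [_ _ dP] B0 PB; rewrite /W2num -integral_qdistZ//.
apply: ge0_le_integral => //.
- move=> t /=; rewrite in_itv/= => t01.
  by rewrite lee_fin mulr_ge0 ?qdist_pos_ge0// ltW// dP.
- exact: measurable_qdist_posM.
- by apply: measurable_funeM; exact: measurable_qdist.
move=> t /=; rewrite in_itv/= => t01; rewrite -EFinM lee_fin mulrC.
have [lt|le] := ltP (quantile G t) (quantile F t).
  by rewrite ler_pM ?qdist_pos_ge0 ?qdist_pos_le ?PB// ltW// dP.
have -> : qdist_pos F G t = 0 by rewrite /qdist_pos max_r ?subr_le0// expr0n.
by rewrite mulr0 mulr_ge0 ?qdist_ge0.
Qed.

Lemma W2num_le_den P : cdf_poly01 P -> (0 <= W2num P <= W2den P)%E.
Proof.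
move=> [_ _ dP]; apply/andP; split.
  apply: integral_ge0 => t /=; rewrite in_itv/= => t01.
  by rewrite lee_fin mulr_ge0 ?qdist_pos_ge0// ltW// dP.
apply: ge0_le_integral => //.
- move=> t /=; rewrite in_itv/= => t01.
  by rewrite lee_fin mulr_ge0 ?qdist_pos_ge0// ltW// dP.
- exact: measurable_qdist_posM.
- exact: measurable_qdistM.
- move=> t /=; rewrite in_itv/= => t01; rewrite lee_fin.
  by rewrite ler_wpM2r ?qdist_pos_le// ltW// dP.
Qed.

(** The density is a polynomial, bounded on [0, 1] by its maximum. Finiteness ensures that [fine]
    keeps the value of the denominator. *)
Lemma W2den_lty P : cdf_poly01 P -> (qdist_int < +oo)%E -> (W2den P < +oo)%E.
Proof.
move=> [_ _ dP] Hoo.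
have [c c01 cM] := EVT_max (@ler01 R) (continuous_subspaceT (@continuous_horner _ P^`())).
have M0 : 0 <= P^`().[c].
  apply: (@le_trans _ _ P^`().[2^-1]); first by rewrite ltW// dP//; lra.
  by apply: cM; rewrite in_itv/=; lra.
apply: (@le_lt_trans _ _ (P^`().[c]%:E * qdist_int)%E); last first.
  rewrite lte_mul_pinfty//; rewrite ?lee_fin.
rewrite /W2den -integral_qdistZ//.
apply: ge0_le_integral => //.
- move=> t /=; rewrite in_itv/= => t01.
  by rewrite lee_fin mulr_ge0 ?qdist_ge0// ltW// dP.
- exact: measurable_qdistM.
- by apply: measurable_funeM; exact: measurable_qdist.
move=> t /=; rewrite in_itv/= => /andP[t0 t1]; rewrite -EFinM lee_fin mulrC.
by rewrite ler_wpM2r ?qdist_ge0// cM// in_itv/= !ltW.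
Qed.

(* Fatou upgrades the pointwise ratio condition to the integrals: the rescaled densities
   blow up pointwise on ]l, r[, hence so does their integral against qdist. *)
Lemma density_over_W2den (P : nat -> {poly R}) a s l r :
  (forall n, cdf_poly01 (P n)) -> (qdist_int < +oo)%E ->
  0 < a < 1 -> 0 <= l -> r <= 1 -> l < s < r -> quantile F s <> quantile G s ->
  (forall b, l < b < r -> (P n)^`().[a] / (P n)^`().[b] @[n --> \oo] --> (0 : R)) ->
  (P n)^`().[a] / fine (W2den (P n)) @[n --> \oo] --> (0 : R).
Proof.
move=> hP Hoo a01 l0 r1 /andP[ls sr] qs ratio.
have d0 n t : 0 < t < 1 -> 0 < (P n)^`().[t] by have [_ _] := hP n; exact.
have s01 : 0 < s < 1 by rewrite (le_lt_trans l0)//= (lt_le_trans sr).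
(* By continuity [qdist] stays above half its value at s on a small interval J around s inside ]l,
   r[. *)
pose m := qdist F G s / 2.
have qs0 : 0 < qdist F G s.
  by rewrite lt0r qdist_ge0 andbT sqrf_eq0 subr_eq0; apply/eqP.
have m0 : 0 < m by rewrite divr_gt0.
have [e e0 He] : exists2 e, 0 < e & forall t, s - e <= t <= s + e -> l < t < r /\ m <= qdist F G t.
  have : \forall t \near s, l < t < r /\ m <= qdist F G t.
    near=> t; split; first by apply/andP; split; near: t; [exact: lt_nbhsr|exact: lt_nbhsl].
    apply: ltW; near: t; apply: (cvgr_gt (qdist F G s)).
      exact: qdist_continuous.
    rewrite /m; lra.
  move=> /nbhs_ballP[e /= e0 He]; exists (e / 2); first by rewrite divr_gt0.
  move=> t te; apply: He; rewrite /ball/= ltr_distlC; lra.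
pose J : set (measurableTypeR R) := `[s - e, s + e]%classic.
have HJ t : J t -> l < t < r /\ m <= qdist F G t.
  by move=> Jt; apply: He; move: Jt; rewrite /J /= in_itv.
have J01 : J `<=` `]0, 1[%classic.
  move=> t /HJ[/andP[lt tr] _] /=; rewrite in_itv/=.
  by rewrite (le_lt_trans l0)//= (lt_le_trans tr).
have J01' t : J t -> 0 < t < 1 by move=> /J01/=; rewrite in_itv.
have mJ : measurable J by exact: measurable_itv.
pose v n t := ((P n)^`().[t] / (P n)^`().[a])%:E.
have mv n : measurable_fun J (v n).
  apply/measurable_EFinP/measurable_funTS; apply: continuous_measurable_fun.
  by move=> t; apply: continuousM; [exact: continuous_horner|exact: cst_continuous].
have v0 n t : J t -> (0 <= v n t)%E.
  by move=> Jt; rewrite lee_fin divr_ge0// ltW// d0// J01'.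
have vy : (\int[mu]_(t in J) v n t @[n --> \oo] --> +oo)%E.
  apply: limn_einf_pinfty; apply/eqP; rewrite -leye_eq.
  have := fatou mu mJ mv v0; apply: le_trans.
  rewrite (eq_integral (cst +oo%E)); last first.
    move=> t; rewrite inE => Jt.
    suff : v ^~ t @ \oo --> +oo%E by move=> /cvg_limn_einf_sup[].
    apply/cvgeryP/gtr0_cvgV0; first by near=> n; rewrite divr_gt0// d0// J01'.
    apply: (@cvg_trans _ ((P n)^`().[a] / (P n)^`().[t] @[n --> \oo])).
      by apply: near_eq_cvg; apply: nearW => n /=; rewrite invf_div.
    by apply: ratio; have [] := HJ _ Jt.
  rewrite integral_cst//=; rewrite lebesgue_measure_itv/= lte_fin.
  rewrite ifT; last lra.
  by rewrite -EFinB mulyr gtr0_sg ?mul1e//; lra.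
(* On J the product of v n with m times the density at a is m times the density, which the integrand
   of the denominator dominates. *)
have vD n : (\int[mu]_(t in J) v n t * (m * (P n)^`().[a])%:E <= W2den (P n))%E.
  rewrite muleC -ge0_integralZl//; last 2 first.
  - by move=> t Jt; exact: v0.
  - by rewrite lee_fin mulr_ge0 ?ltW// d0.
  apply: (@le_trans _ _ (\int[mu]_(t in J) (qdist F G t * (P n)^`().[t])%:E)%E).
    apply: ge0_le_integral => //.
    - by move=> t Jt; rewrite mule_ge0 ?v0// lee_fin mulr_ge0 ?ltW// d0.
    - exact: measurable_funeM.
    - by apply: measurable_funS (measurable_qdistM (P n)).
    - move=> t Jt; rewrite -EFinM lee_fin.
      have -> : m * (P n)^`().[a] * ((P n)^`().[t] / (P n)^`().[a]) = m * (P n)^`().[t].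
        by field; rewrite gt_eqF// d0.
      rewrite ler_wpM2r ?(ltW (d0 _ _ (J01' _ Jt)))//.
      by have [] := HJ _ Jt.
  apply: ge0_subset_integral => //.
  - exact: measurable_qdistM.
  - move=> t /=; rewrite in_itv/= => t01.
    by rewrite lee_fin mulr_ge0 ?qdist_ge0// ltW// d0.
apply/cvgrPdist_le => k k0.
(* Once the integral of v n exceeds 1 / (k m), the denominator exceeds the density at a divided by
   k. *)
have /cvgeyPge/(_ (k * m)^-1) := vy; apply: filterS => n vn.
have Pa : 0 < (P n)^`().[a] by exact: d0.
have Dfin : (W2den (P n)) \is a fin_num.
  rewrite ge0_fin_numE ?W2den_lty//.
  by have /andP[/le_trans] := W2num_le_den (hP n); exact.
have : ((k * m)^-1 * (m * (P n)^`().[a]) <= fine (W2den (P n))).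
  rewrite -lee_fin fineK//; apply: le_trans (vD n).
  by rewrite EFinM lee_wpmul2r// lee_fin mulr_ge0 ?ltW.
have -> : (k * m)^-1 * (m * (P n)^`().[a]) = (P n)^`().[a] / k.
  by field; rewrite !gt_eqF.
move=> le.
have D0 : 0 < fine (W2den (P n)) by rewrite (lt_le_trans _ le)// divr_gt0.
rewrite sub0r normrN gtr0_norm ?divr_gt0//.
by rewrite ler_pdivrMr// mulrC -ler_pdivrMr.
Unshelve. all: by end_near. Qed.

End asymptotics.

(** * Mixtures of the phi_n and the location of their ranks *)

Section mixture.
Context {R : realType}.
Implicit Types (n p : nat) (t : R).

Definition mix_poly p n (alpha gam : 'I_p -> R) : {poly R} :=
  \sum_(i < p) alpha i *: phi_poly n (gam i).

Lemma phi_mixE p n (alpha gam : 'I_p -> R) :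
  phi_mix n alpha gam = horner (mix_poly n alpha gam).
Proof.
apply/funext => t; rewrite /phi_mix /mix_poly horner_sum; apply: eq_bigr => i _.
by rewrite hornerZ horner_phi_poly.
Qed.

Lemma deriv_mix_poly p n (alpha gam : 'I_p -> R) t : (0 < n)%N -> (forall i, gam i <= 1) ->
  (mix_poly n alpha gam)^`().[t] =
  \sum_(i < p) alpha i * beta_density n (Num.truncn (n.-1%:R * gam i)) t.
Proof.
move=> n0 g1; rewrite /mix_poly (raddf_sum (@deriv R)) horner_sum; apply: eq_bigr => i _.
by rewrite /= derivZ hornerZ deriv_phi_poly.
Qed.

Lemma ge_component_mix_poly p n (alpha gam : 'I_p -> R) t i :
  (0 < n)%N -> (forall i, gam i <= 1) -> (forall i, 0 < alpha i) -> 0 <= t <= 1 ->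
  alpha i * beta_density n (Num.truncn (n.-1%:R * gam i)) t <= (mix_poly n alpha gam)^`().[t].
Proof.
move=> n0 g1 a0 t01; rewrite deriv_mix_poly// (bigD1 i)//= lerDl sumr_ge0// => j _.
by rewrite mulr_ge0 ?beta_density_ge0// ltW.
Qed.

Lemma cdf_poly01_mix p n (alpha gam : 'I_p -> R) :
  (0 < n)%N -> (forall i, gam i <= 1) -> (forall i, 0 < alpha i) ->
  \sum_(i < p) alpha i = 1 -> cdf_poly01 (mix_poly n alpha gam).
Proof.
move=> n0 g1 a0 a1; split.
- rewrite /mix_poly horner_sum big1// => i _.
  by rewrite hornerZ horner_phi_poly phi0 mulr0.
- rewrite /mix_poly horner_sum -[RHS]a1; apply: eq_bigr => i _.
  by rewrite hornerZ horner_phi_poly phi1 ?mulr1.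
(* Weights of sum 1 rule out the empty mixture, and a single component already makes the density
   positive. *)
- move=> t t01; case: p alpha gam g1 a0 a1 => [|p] alpha gam g1 a0 a1.
    by move: a1 => /eqP; rewrite big_ord0 eq_sym oner_eq0.
  have t01' : 0 <= t <= 1 by have /andP[/ltW-> /ltW->] := t01.
  apply: lt_le_trans (ge_component_mix_poly ord0 n0 g1 a0 t01').
  by rewrite mulr_gt0// beta_density_gt0// truncn_rank_lt.
Qed.

(** Truncation loses less than 1, while with d half the distance from a to g the margin n d is at
    least 1 for large n. So the mode k / n of the beta density is eventually not to the left of
    a. *)
Lemma rank_near_ge (gn : nat -> R) (g a : R) : (forall n, 0 <= gn n) ->
  gn @ \oo --> g -> a < g ->
  \forall n \near \oo, n%:R * a <= (Num.truncn (n%:R * gn n))%:R.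
Proof.
move=> gn0 gng ag; pose d := (g - a) / 2; have d0 : 0 < d by rewrite divr_gt0// subr_gt0.
have h1 : \forall n \near \oo, a + d < gn n.
  by apply: (cvgr_gt g gng); rewrite /d; lra.
near=> n.
have := truncnS_gt (n%:R * gn n); rewrite -natr1.
have : n%:R * (a + d) <= n%:R * gn n.
  by rewrite ler_wpM2l// ltW//; near: n.
have : d^-1 <= n%:R by near: n; exact: nbhs_infty_ger.
rewrite -(ler_pM2r d0) mulVf ?gt_eqF//; nra.
Unshelve. all: by end_near. Qed.

Lemma rank_near_le (gn : nat -> R) (g a : R) : (forall n, 0 <= gn n) ->
  gn @ \oo --> g -> g < a ->
  \forall n \near \oo, (Num.truncn (n%:R * gn n))%:R <= n%:R * a.
Proof.
move=> gn0 gng ag; near=> n.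
apply: (@le_trans _ _ (n%:R * gn n)); first by rewrite truncn_le mulr_ge0.
by rewrite ler_wpM2l// ltW//; near: n; exact: (cvgr_lt g gng).
Unshelve. all: by end_near. Qed.

Lemma cvg_of_O1n (gn : nat -> R) (g : R) :
  (exists C : R, exists N : nat, forall n : nat, (N <= n)%N -> `|gn n - g| <= C / n%:R) ->
  gn @ \oo --> g.
Proof.
move=> [C [N CN]]; apply/cvgrPdist_le => e e0; near=> n.
have n0 : 0 < n%:R :> R by rewrite ltr0n; near: n; exact: nbhs_infty_gt.
rewrite distrC; apply: (@le_trans _ _ (C / n%:R)); first by apply: CN; near: n; exact: nbhs_infty_ge.
rewrite ler_pdivrMr// mulrC -ler_pdivrMr//; near: n; exact: nbhs_infty_ger.
Unshelve. all: by end_near. Qed.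

End mixture.

(** * A negligible bound for one component of the mixture density *)

Section component_bound.
Context {R : realType}.
Variables (F G : R -> R).
Hypotheses (hF : incr_onto01 F) (hG : incr_onto01 G).
Hypothesis Hoo : (qdist_int F G < +oo)%E.
(** Here f stands for one weighted beta density, and the derivative of P for the whole mixture
    density above it. [f_left] and [f_right] express unimodality with a mode tending to g. *)
Variables (P : nat -> {poly R}) (f : nat -> R -> R) (g dl : R).
Hypothesis hP : forall n, cdf_poly01 (P n).
Hypothesis g01 : 0 <= g <= 1.
Hypothesis fP : forall n t, 0 < t < 1 -> f n t <= (P n)^`().[t].
Hypothesis f_left : forall a, 0 < a < 1 -> a < g ->
  \forall n \near \oo, forall t, 0 < t <= a -> f n t <= f n a.
Hypothesis f_right : forall a, 0 < a < 1 -> g < a ->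
  \forall n \near \oo, forall t, a <= t < 1 -> f n t <= f n a.
Hypothesis ratio : forall a b, 0 <= a <= 1 ->
  (g - dl <= a /\ a < b /\ b < g) \/ (g < b /\ b < a /\ a <= g + dl) ->
  (P n)^`().[a] / (P n)^`().[b] @[n --> \oo] --> (0 : R).
Hypothesis gapl : (exists u, A2 F G u /\ 0 < u < g) ->
  Fext F (c_ F G g) < Fext F (a_ F G g) /\ g - dl < Fext F (a_ F G g).
Hypothesis gapr : (exists u, A2 F G u /\ g < u < 1) ->
  Fext F (b_ F G g) < Fext F (d_ F G g) /\ Fext F (b_ F G g) < g + dl.

Let negligible (B : nat -> R) :=
  (forall n, 0 <= B n) /\ B n / fine (W2den F G (P n)) @[n --> \oo] --> (0 : R).

Let negligible0 : negligible (fun=> 0).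
Proof. by split=> //; under eq_fun do rewrite mul0r; exact: cvg_cst. Qed.

Let deriv_ge0 n a : 0 < a < 1 -> 0 <= (P n)^`().[a].
Proof. by move=> a01; have [_ _ /(_ _ a01)/ltW] := hP n. Qed.

(** If [A0] has no point up to g, the bound is 0. Otherwise take the gap ]a, g[: unimodality bounds
    f at t by f at a, hence by the mixture density at a, which is negligible since the quantiles
    differ at some s in the gap. *)
Let left_bound : exists2 B, negligible B &
  \forall n \near \oo, forall t, A0 F G t -> t <= g -> f n t <= B n.
Proof.
have [[t0 At0 t0g]|no] := pselect (exists2 t, A0 F G t & t <= g); last first.
  by exists (fun=> 0) => //; near=> n => t At tg; exfalso; apply: no; exists t.
have [g0 g1] := andP g01.
have [a [s [a01 ga /andP[as_ sg] qs Aa]]] := left_gap hF hG g1 At0 t0g gapl.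
have [a0 a1] := andP a01.
exists (fun n => (P n)^`().[a]).
  split=> [n|]; first exact: deriv_ge0.
  apply: (@density_over_W2den R F G hF hG P a s a g) => //; first exact: ltW.
    by rewrite as_.
  move=> b /andP[ab bg]; apply: ratio; first by rewrite !ltW.
  by left.
have ag : a < g by exact: lt_trans sg.
near=> n => t At tg; apply: (@le_trans _ _ (f n a)); last exact: fP.
have : forall t, 0 < t <= a -> f n t <= f n a by near: n; exact: f_left.
by apply; rewrite Aa// andbT; case: At => /andP[].
Unshelve. all: by end_near. Qed.

(** The same argument on the other side, with the gap ]g, a[. *)
Let right_bound : exists2 B, negligible B &
  \forall n \near \oo, forall t, A0 F G t -> g <= t -> f n t <= B n.
Proof.
have [[t0 At0 t0g]|no] := pselect (exists2 t, A0 F G t & g <= t); last first.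
  by exists (fun=> 0) => //; near=> n => t At tg; exfalso; apply: no; exists t.
have [g0 g1] := andP g01.
have [a [s [a01 ga /andP[gs sa] qs Aa]]] := right_gap hF hG g0 At0 t0g gapr.
have [a0 a1] := andP a01.
exists (fun n => (P n)^`().[a]).
  split=> [n|]; first exact: deriv_ge0.
  apply: (@density_over_W2den R F G hF hG P a s g a) => //; first exact: ltW.
    by rewrite gs.
  move=> b /andP[ab bg]; apply: ratio; first by rewrite !ltW.
  by right.
have ag : g < a by exact: lt_trans sa.
near=> n => t At tg; apply: (@le_trans _ _ (f n a)); last exact: fP.
have : forall t, a <= t < 1 -> f n t <= f n a by near: n; exact: f_right.
by apply; rewrite Aa//; case: At => /andP[].
Unshelve. all: by end_near. Qed.

Lemma component_bound : exists B : nat -> R,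
  [/\ forall n, 0 <= B n,
      B n / fine (W2den F G (P n)) @[n --> \oo] --> (0 : R) &
      \forall n \near \oo, forall t, A0 F G t -> f n t <= B n].
Proof.
have [BL [BL0 BLc] BLb] := left_bound; have [BR [BR0 BRc] BRb] := right_bound.
exists (fun n => BL n + BR n); split=> [n||].
- by rewrite addr_ge0.
- under eq_fun do rewrite mulrDl.
  by have := cvgD BLc BRc; rewrite addr0; apply.
- near=> n => t At; have [tg|/ltW gt] := leP t g.
    by rewrite (le_trans (y := BL n)) ?lerDl//; move: t At tg; near: n.
  by rewrite (le_trans (y := BR n)) ?lerDr//; move: t At gt; near: n.
Unshelve. all: by end_near. Qed.

End component_bound.

(** * Finiteness of the distance between the two cdfs *)

Section finite_distance.
Context {R : realType}.
Local Notation mu := (@lebesgue_measure R).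

(** From (x - y)^2 <= 2 (x^2 + y^2), where the squared quantiles integrate to the second moments. *)
Lemma qdist_int_lty (dX : measure_display) (TX : measurableType dX) (PX : probability TX R)
  (X : {RV PX >-> R}) (dY : measure_display) (TY : measurableType dY)
  (PY : probability TY R) (Y : {RV PY >-> R}) :
  continuous (cdfR X) -> {homo cdfR X : x y / x < y} ->
  continuous (cdfR Y) -> {homo cdfR Y : x y / x < y} ->
  ('E_PX[fun t => (X t ^+ 2)%R] < +oo)%E -> ('E_PY[fun t => (Y t ^+ 2)%R] < +oo)%E ->
  (qdist_int (cdfR X) (cdfR Y) < +oo)%E.
Proof.
move=> cX sX cY sY; have hX := cdfR_onto01 cX sX; have hY := cdfR_onto01 cY sY.
rewrite -(integral_quantile_sqr cX sX) -(integral_quantile_sqr cY sY).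
set qX := quantile (cdfR X); set qY := quantile (cdfR Y) => EX EY.
have mq F : incr_onto01 F ->
    measurable_fun (`]0, 1[%classic : set R) (EFin \o (fun u => quantile F u ^+ 2)).
  move=> hF; apply/measurable_EFinP.
  apply: (@measurable_fun_itv01 R (fun u => quantile F u ^+ 2)) => u u01.
  apply: (@continuous_comp _ _ _ (quantile F) (fun x => x ^+ 2)).
    exact: quantile_continuous.
  exact: exprn_continuous.
have mX := mq _ hX; have mY := mq _ hY.
have E : (\int[mu]_(u in `]0%R, 1%R[) (2%:E * ((qX u ^+ 2)%:E + (qY u ^+ 2)%:E)) < +oo)%E.
  rewrite ge0_integralZl//; last 2 first.
  - exact: emeasurable_funD.
  - by move=> u _; rewrite adde_ge0 ?lee_fin ?sqr_ge0.
  rewrite ge0_integralD//; last 2 first.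
  - by move=> u _; rewrite lee_fin sqr_ge0.
  - by move=> u _; rewrite lee_fin sqr_ge0.
  by rewrite lte_mul_pinfty// lte_add_pinfty.
apply: le_lt_trans E; apply: ge0_le_integral => //.
- by move=> u _; rewrite lee_fin qdist_ge0.
- exact: measurable_qdist.
- by apply: measurable_funeM; exact: emeasurable_funD.
move=> u _; rewrite -EFinD -EFinM lee_fin /qdist -/qX -/qY.
by have := sqr_ge0 (qX u + qY u); nra.
Qed.

End finite_distance.

(** * Convergence of epsilon to 0 *)

Unset Implicit Arguments.
Theorem theorem5p4 (R : realType)
  (dX : measure_display) (TX : measurableType dX) (PX : probability TX R) (X : {RV PX >-> R})
  (dY : measure_display) (TY : measurableType dY) (PY : probability TY R) (Y : {RV PY >-> R})
  (p : nat) (gam alpha delta : 'I_p -> R) (gamn : 'I_p -> nat -> R) :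
  (* 0 <= gamma_1 < ... < gamma_p <= 1 *)
  (forall i, 0 <= gam i <= 1) ->
  (forall i j : 'I_p, (i < j)%N -> gam i < gam j) ->
  (* alpha in (0,1)^p, sum alpha = 1 *)
  (forall i, 0 < alpha i < 1) ->
  \sum_(i < p) alpha i = 1 ->
  (* gamma_{i,n} in [0,1], |gamma_{i,n} - gamma_i| = O(1/n) *)
  (forall i n, 0 <= gamn i n <= 1) ->
  (forall i, exists C : R, exists N : nat, forall n : nat, (N <= n)%N ->
     `|gamn i n - gam i| <= C / n%:R) ->
  (* F_X, F_Y continuous, strictly increasing; finite second moments *)
  continuous (cdfR X) -> {homo cdfR X : x y / x < y} ->
  continuous (cdfR Y) -> {homo cdfR Y : x y / x < y} ->
  ('E_PX[fun t => (X t ^+ 2)%R] < +oo)%E -> ('E_PY[fun t => (Y t ^+ 2)%R] < +oo)%E ->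
  (* delta_i > 0, (gamma_i - delta_i, gamma_i + delta_i) /\ [0,1] pairwise disjoint *)
  (forall i, 0 < delta i) ->
  (forall i j : 'I_p, i != j -> forall u : R, 0 <= u <= 1 ->
     ~ (`|u - gam i| < delta i /\ `|u - gam j| < delta j)) ->
  (* ratio condition on the derivative of phi_{n,alpha,gamma_n} *)
  (forall i (a b : R), 0 <= a <= 1 ->
     (gam i - delta i <= a /\ a < b /\ b < gam i) \/
     (gam i < b /\ b < a /\ a <= gam i + delta i) ->
     (fun n : nat => derive1 (phi_mix n alpha (gamn^~ n)) a / derive1 (phi_mix n alpha (gamn^~ n)) b)
       @ \oo --> (0 : R)) ->
  (* (A1) *)
  (forall i, (exists u, A2 (cdfR X) (cdfR Y) u /\ 0 < u < gam i) ->
     Fext (cdfR X) (c_ (cdfR X) (cdfR Y) (gam i)) < Fext (cdfR X) (a_ (cdfR X) (cdfR Y) (gam i)) /\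
     gam i - delta i < Fext (cdfR X) (a_ (cdfR X) (cdfR Y) (gam i))) ->
  (* (A2) *)
  (forall i, (exists u, A2 (cdfR X) (cdfR Y) u /\ gam i < u < 1) ->
     Fext (cdfR X) (b_ (cdfR X) (cdfR Y) (gam i)) < Fext (cdfR X) (d_ (cdfR X) (cdfR Y) (gam i)) /\
     Fext (cdfR X) (b_ (cdfR X) (cdfR Y) (gam i)) < gam i + delta i) ->
  (* X_{n,alpha,gamma_n} <=_{d-ast} Y_{n,alpha,gamma_n} *)
  (fun n : nat => epsW2 (phi_mix n alpha (gamn^~ n) \o cdfR X)
                        (phi_mix n alpha (gamn^~ n) \o cdfR Y)) @ \oo --> (0 : R).
Proof.
move=> gam01 _ alpha01 alpha1 gamn01 gamnO cX sX cY sY EX EY _ _ ratio A1 A2.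
have hF := cdfR_onto01 cX sX; have hG := cdfR_onto01 cY sY.
have Hoo := qdist_int_lty cX sX cY sY EX EY.
move: (cdfR X) (cdfR Y) hF hG Hoo A1 A2 => F G hF hG Hoo A1 A2 {cX sX cY sY EX EY}.
have gamn1 i n : gamn i n <= 1 by have /andP[] := gamn01 i n.
have gamn0 i n : 0 <= gamn i n by have /andP[] := gamn01 i n.
have alpha0 i : 0 < alpha i by have /andP[] := alpha01 i.
(* Sample sizes are shifted to n + 1: for size 0 the sum defining [phi] is empty and gives no
   cdf. *)
pose P n := mix_poly n.+1 alpha (gamn^~ n.+1).
have hP n : cdf_poly01 (P n) by exact: cdf_poly01_mix.
pose k i n := Num.truncn (n%:R * gamn i n.+1).
have dP n t : (P n)^`().[t] = \sum_(i < p) alpha i * beta_density n.+1 (k i n) t.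
  by rewrite deriv_mix_poly.
have kn i n : (k i n < n.+1)%N by exact: (@truncn_rank_lt R n.+1).
have gamn_cvg i : gamn i n.+1 @[n --> \oo] --> gam i.
  by rewrite (cvg_shiftS (gamn i)); exact: cvg_of_O1n.
have bound i : exists B : nat -> R,
  [/\ forall n, 0 <= B n,
      B n / fine (W2den F G (P n)) @[n --> \oo] --> (0 : R) &
      \forall n \near \oo, forall t, A0 F G t ->
        alpha i * beta_density n.+1 (k i n) t <= B n].
  apply: (@component_bound R F G hF hG Hoo P
    (fun n t => alpha i * beta_density n.+1 (k i n) t) (gam i) (delta i)) => //.
  - move=> n t /andP[/ltW t0 /ltW t1]; apply: ge_component_mix_poly => //.
    by rewrite t0.
  (* For large n the point a is not beyond the mode, so the component is largest at a among the t <=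
     a; the next case is symmetric. *)
  - move=> a a01 ag; have := rank_near_ge (fun n => gamn0 i n.+1) (gamn_cvg i) ag.
    apply: filterS => n ka t /andP[t0 ta].
    rewrite ler_pM2l// beta_density_unimodal//.
      by rewrite t0/= (le_lt_trans ta)//; have /andP[] := a01.
    by rewrite mulr_le0_ge0// ?subr_le0 ?subr_ge0.
  - move=> a a01 ag; have := rank_near_le (fun n => gamn0 i n.+1) (gamn_cvg i) ag.
    apply: filterS => n ka t /andP[ta t1].
    rewrite ler_pM2l// beta_density_unimodal//.
      by rewrite t1 andbT (lt_le_trans _ ta)//; have /andP[] := a01.
    by rewrite mulr_ge0_le0// ?subr_le0 ?subr_ge0.
  - move=> a b a01 ab; have := ratio i a b a01 ab.
    rewrite -(cvg_shiftS (fun n => derive1 (phi_mix n alpha (gamn^~ n)) a /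
      derive1 (phi_mix n alpha (gamn^~ n)) b)).
    by under eq_fun do rewrite phi_mixE -!derivE.
  - exact: A1.
  - exact: A2.
have [B HB] := choice bound.
rewrite -cvg_shiftS.
pose H := fine (qdist_int F G).
have H0 : (0 <= qdist_int F G)%E.
  by apply: integral_ge0 => t _; rewrite lee_fin qdist_ge0.
have Hfin : qdist_int F G \is a fin_num by rewrite ge0_fin_numE.
have eps n : epsW2 (phi_mix n.+1 alpha (gamn^~ n.+1) \o F)
    (phi_mix n.+1 alpha (gamn^~ n.+1) \o G) =
    fine (W2num F G (P n)) / fine (W2den F G (P n)).
  by rewrite /epsW2 phi_mixE (W2sq_poly (hP n) hF hG) (W2sq_pos_poly (hP n) hF hG).
under eq_fun do rewrite eps.
have nB : \forall n \near \oo, forall i t, A0 F G t ->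
    alpha i * beta_density n.+1 (k i n) t <= B i n.
  by apply: filter_forall => i; have [] := HB i.
(* On [A0] the mixture density is at most the sum of the B i n, so the numerator is at most H times
   that sum, and each B i n is negligible against the denominator. *)
apply: (@squeeze_cvgr _ _ _ _ (fun=> 0)
  (fun n => H * \sum_(i < p) (B i n / fine (W2den F G (P n))))).
- near=> n.
  have /andP[N0 ND] := W2num_le_den hF hG (hP n).
  (* Nonnegativity suffices: for a zero denominator both quotients are 0 by convention. *)
  have D0 : 0 <= fine (W2den F G (P n)) by rewrite fine_ge0// (le_trans N0).
  apply/andP; split; first by rewrite divr_ge0// fine_ge0.
  rewrite -mulr_suml mulrA; apply: ler_wpM2r; first by rewrite invr_ge0.
  have SB0 : 0 <= \sum_(i < p) B i n.
    by apply: sumr_ge0 => i _; have [] := HB i.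
  have : (W2num F G (P n) <= (\sum_(i < p) B i n)%:E * qdist_int F G)%E.
    apply: le_W2num => // t At; rewrite dP; apply: ler_sum => i _.
    by move: i t At; near: n.
  rewrite -(fineK Hfin) -EFinM => NB.
  have Nfin : W2num F G (P n) \is a fin_num.
    by rewrite ge0_fin_numE// (le_lt_trans NB)// ltry.
  by rewrite -lee_fin fineK// mulrC.
- exact: cvg_cst.
- have S0 : \sum_(i < p) (B i n / fine (W2den F G (P n))) @[n --> \oo] --> (0 : R).
    by apply: cvg_sum0 => i; have [] := HB i.
  by have := cvgM (cvg_cst H) S0; rewrite mulr0; apply.
Unshelve. all: by end_near. Qed.
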